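(* Let $F : \mathbb{C}^n \to \mathbb{C}^n$ be entire, and suppose the Koopman operator $\mathcal{K}_F g = g\circ F$ is bounded on $H_G(\mathbb{C}^n)$ (with domain all of $H_G(\mathbb{C}^n)$). Then there exist a matrix $A \in \mathbb{C}^{n\times n}$ and a vector $b \in \mathbb{C}^n$ such that $F(z) = Az + b$ for all $z \in \mathbb{C}^n$.
   Context: $H_G(\mathbb{C}^n)$ denotes the RKHS of entire functions on $\mathbb{C}^n$ with reproducing kernel $K_G(z,w) = \exp\!\left(-\tfrac12 \sum_{j=1}^n (z_j - \overline{w_j})^2\right)$. This is the complexified native space of the Gaussian RBF kernel $\exp(-\|x-y\|^2/2)$. Equivalently, $H_G(\mathbb{C}^n) = \{ g(z)e^{-\sum_j z_j^2/2} : g\in F^2(\mathbb{C}^n)\}$, where $F^2(\mathbb{C}^n)$ is the Fock space with kernel $e^{\sum_j \overline{w_j}z_j}$. *)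

(* Defs.v *)
From HB Require Import structures.
From mathcomp Require Import all_boot all_order all_algebra.
From mathcomp Require Import all_classical all_reals all_analysis.
From mathcomp.real_closed Require Import complex.
Set Implicit Arguments. Unset Strict Implicit. Unset Printing Implicit Defensive.
Import Order.TTheory GRing.Theory Num.Theory.
Local Open Scope ring_scope.
Local Open Scope classical_set_scope.

Section HG.
Variables (R : realType) (n : nat).
Local Notation C := (R[i]).

Definition mindex := {ffun 'I_n -> nat}.

Definition monom (z : 'cV[C]_n) (al : mindex) : C :=
  \prod_(j < n) z j 0 ^+ al j.

Definition mfact (al : mindex) : nat := \prod_(j < n) (al j)`!.

Definition mdeg (al : mindex) : nat := \sum_(j < n) al j.

Definition mindex_of (N : nat) (be : {ffun 'I_n -> 'I_N.+1}) : mindex :=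
  [ffun j => nat_of_ord (be j)].

Definition psum (a : mindex -> C) (z : 'cV[C]_n) (N : nat) : C :=
  \sum_(be : {ffun 'I_n -> 'I_N.+1} | (mdeg (mindex_of be) <= N)%N)
     a (mindex_of be) * monom z (mindex_of be).

Definition series_to (a : mindex -> C) (z : 'cV[C]_n) (l : C) : Prop :=
  forall e : R, 0 < e -> exists N : nat, forall m : nat, (N <= m)%N ->
    ComplexField.Normc.normc (psum a z m - l) < e.

Definition abs_summable (a : mindex -> C) (z : 'cV[C]_n) : Prop :=
  (\esum_(al in [set: mindex]) (ComplexField.Normc.normc (a al * monom z al))%:E < +oo)%E.

Definition entire (f : 'cV[C]_n -> C) : Prop :=
  exists a : mindex -> C, forall z, abs_summable a z /\ series_to a z (f z).

Definition entire_map (F : 'cV[C]_n -> 'cV[C]_n) : Prop :=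
  forall j : 'I_n, entire (fun z => F z j 0).

(* Fock space F^2(C^n) (kernel e^{<z,w>}): g = sum_alpha a_alpha z^alpha with
   ||g||^2 = sum_alpha |a_alpha|^2 alpha! < oo *)
Definition fock_norm2 (a : mindex -> C) : \bar R :=
  (\esum_(al in [set: mindex]) (ComplexField.Normc.normc (a al) ^+ 2 * (mfact al)%:R)%:E)%E.

Definition fock_rep (a : mindex -> C) (g : 'cV[C]_n -> C) : Prop :=
  (fock_norm2 a < +oo)%E /\ forall z, series_to a z (g z).

Definition cexp (w : C) : C :=
  let: Complex x y := w in ((expR x * cos y) +i* (expR x * sin y))%C.

Definition sumsq (z : 'cV[C]_n) : C := \sum_(j < n) z j 0 ^+ 2.

(* h in H_G(C^n) with coefficient sequence a:
   h(z) = g(z) e^{-sum_j z_j^2/2}, g in F^2 with Taylor coefficients a;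
   then ||h||_{H_G}^2 = ||g||_{F^2}^2 = fock_norm2 a. *)
Definition HG_rep (a : mindex -> C) (h : 'cV[C]_n -> C) : Prop :=
  exists g : 'cV[C]_n -> C, fock_rep a g /\
    forall z, h z = g z * cexp (- (sumsq z / 2%:R)).

Definition koopman_bounded (F : 'cV[C]_n -> 'cV[C]_n) : Prop :=
  exists C0 : R, 0 <= C0 /\
    forall (a : mindex -> C) (h : 'cV[C]_n -> C), HG_rep a h ->
      exists b : mindex -> C, HG_rep b (fun z => h (F z)) /\
        (fock_norm2 b <= (C0 ^+ 2)%:E * fock_norm2 a)%E.

End HG.

(* Main.v *)
(** Let [K_w] be the reproducing kernel at [w].  The adjoint of the Koopman
    operator sends [K_z] to [K_(F z)], and [|K_z|^2 = exp (2 |Im z|^2)], so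
    boundedness gives [|Im (F z)|^2 <= |Im z|^2 + const].  Hence, for fixed [z],
    the entire function [l |-> F_j (l z)] of one variable has imaginary part of
    at most linear growth.  Its Taylor coefficients on the circle of radius [r]
    are Fourier coefficients of this imaginary part, so that those of degree at
    least 2, which are the homogeneous parts of [F_j] evaluated at [z], vanish. *)

Require Import Defs.
From HB Require Import structures.
From mathcomp Require Import all_boot all_order all_algebra.
From mathcomp Require Import all_classical all_reals all_analysis.
From mathcomp.real_closed Require Import complex.
From mathcomp Require Import cyclic separable cyclotomic.
From mathcomp Require Import ring lra zify.
Set Implicit Arguments. Unset Strict Implicit. Unset Printing Implicit Defensive.
Import Order.TTheory GRing.Theory Num.Theory.
Import numFieldNormedType.Exports ComplexField.Normc.
Local Open Scope ring_scope.

(** * Roots of unity, the modulus, and coefficient bounds on a circle *)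

Lemma prim_root_exists (K : numClosedFieldType) (N : nat) :
  (0 < N)%N -> exists w : K, N.-primitive_root w.
Proof.
move=> N0; pose p : {poly K} := 'X^N - 1.
have [r Dp] := closed_field_poly_normal p.
rewrite (monicP _) ?monicXnsubC // scale1r in Dp.
have rn1 : all N.-unity_root r by apply/allP=> z; rewrite -root_prod_XsubC -Dp.
have sz_r : (N < (size r).+1)%N.
  by rewrite -(size_prod_XsubC r id) -Dp size_XnsubC.
have [|w] := hasP (has_prim_root N0 rn1 _ sz_r); last by exists w.
(* In characteristic zero ['X^N - 1] is separable, so its N roots are distinct, as [has_prim_root]
   requires. *)
by rewrite -separable_prod_XsubC -Dp separable_Xn_sub_1 // pnatr_eq0 -lt0n.
Qed.

(** A geometric sum of ratio w^m, which differs from 1; multiplied by w^m - 1 it telescopes to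
    w^(mN) - 1 = 0. *)
Lemma sum_expr_prim_root (K : fieldType) (N m : nat) (w : K) :
  N.-primitive_root w -> ~~ (N %| m)%N -> \sum_(k < N) (w ^+ k) ^+ m = 0.
Proof.
move=> prw; rewrite (prim_order_dvd prw); rewrite -subr_eq0 => wm.
apply: (mulfI wm); rewrite mulr0.
under eq_bigr do rewrite exprAC.
by rewrite -subrX1 exprAC (prim_expr_order prw) expr1n subrr.
Qed.

Lemma normc_sum (R : rcfType) (I : Type) (s : seq I) (P : pred I) (f : I -> R[i]) :
  normc (\sum_(i <- s | P i) f i) <= \sum_(i <- s | P i) normc (f i).
Proof.
elim/big_rec2: _ => [|i x y _ h]; first by rewrite normc0.
by apply: le_trans (le_normcD _ _) _; rewrite lerD2l.
Qed.

Lemma normcX (R : rcfType) (x : R[i]) k : normc (x ^+ k) = normc x ^+ k.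
Proof. by elim: k => [|k ih]; rewrite ?normc1 // !exprS normcM ih. Qed.

Lemma normc_ge0 (R : rcfType) (x : R[i]) : 0 <= normc x.
Proof. by case: x => a b; rewrite sqrtr_ge0. Qed.

Lemma normc_real (R : rcfType) (x : R) : normc x%:C%C = `|x|.
Proof. by rewrite /= expr0n addr0 sqrtr_sqr. Qed.

Lemma normc_nat (R : rcfType) k : normc (k%:R : R[i]) = k%:R.
Proof. by rewrite -(rmorph_nat (real_complex R)) normc_real ger0_norm. Qed.

Lemma normc_conj (R : rcfType) (x : R[i]) : normc x^*%C = normc x.
Proof. by case: x => a b /=; rewrite sqrrN. Qed.

Lemma mulc_conj (R : rcfType) (x : R[i]) : x * x^*%C = (normc x ^+ 2)%:C%C.
Proof. by rewrite -sqr_normc rmorphXn; case: x. Qed.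

(* Discrete Fourier analysis on the circle of radius r: averaging
   2i Im p(r w^k) against the conjugate of (w^k)^d, over the k-th powers of a
   primitive root of unity w of order > 2M, picks out c_d r^d. *)
Lemma coef_le_Im (R : rcfType) (c : nat -> R[i]) (M d : nat) (r B : R) :
  0 <= r -> (0 < d <= M)%N ->
  (forall l, normc l = r -> `|complex.Im (\sum_(m < M.+1) c m * l ^+ m)| <= B) ->
  normc (c d) * r ^+ d <= 2 * B.
Proof.
move=> r0 /andP[d0 dM] hB; pose N := (2 * M).+1.
have [w prw] : exists w : R[i], N.-primitive_root w by exact: prim_root_exists.
have w1 : normc w = 1.
  apply/eqP; rewrite -(@pexpr_eq1 _ _ N) ?normc_ge0 //.
  by rewrite -normcX (prim_expr_order prw) normc1.
pose p (l : R[i]) := \sum_(m < M.+1) c m * l ^+ m.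
have wN k : (w ^+ k) ^+ N = 1 by rewrite exprAC (prim_expr_order prw) expr1n.
have sum_p e : \sum_(k < N) p (r%:C%C * w ^+ k) * (w ^+ k) ^+ e
    = \sum_(m < M.+1) c m * r%:C%C ^+ m * \sum_(k < N) (w ^+ k) ^+ (m + e).
  rewrite /p; under eq_bigr do rewrite mulr_suml.
  rewrite exchange_big; apply: eq_bigr => m _; rewrite mulr_sumr.
  by apply: eq_bigr => k _; rewrite exprMn exprD; ring.
(* On the unit circle conjugation is inversion, so the exponent N - d stands for -d. *)
have conj_w k : ((w ^+ k) ^+ (N - d))^*%C = (w ^+ k) ^+ d.
  have x1 : (w ^+ k) * (w ^+ k)^*%C = 1 by rewrite mulc_conj normcX w1 !expr1n.
  have xN : (w ^+ k) ^+ (N - d) * (w ^+ k) ^+ d = 1.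
    by rewrite -exprD subnK ?wN //; lia.
  rewrite rmorphXn -[RHS]mul1r -[in RHS](expr1n _ (N - d)) -x1 exprMn.
  by rewrite mulrAC xN mul1r.
(* For m <= M, N divides m + N - d only when m = d. *)
have Dp : \sum_(k < N) p (r%:C%C * w ^+ k) * (w ^+ k) ^+ (N - d)
    = N%:R * (c d * r%:C%C ^+ d).
  rewrite sum_p (bigD1 (Ordinal (dM : d < M.+1)%N)) //=.
  rewrite [X in _ + X]big1 ?addr0 => [|m md].
    rewrite subnKC; last lia.
    by under eq_bigr do rewrite wN; rewrite sumr_const card_ord mulrC.
  rewrite sum_expr_prim_root ?mulr0 //; apply: contra md => /dvdnP[q Eq].
  have := ltn_ord m; rewrite -val_eqE /= /N in Eq * => mM.
  by apply/eqP; case: q Eq => [|[|q]] Eq; nia.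
(* Conjugating turns the exponents into m + d, which lie strictly between 0 and N = 2M + 1; this is
   where 0 < d matters. *)
have Dc : \sum_(k < N) (p (r%:C%C * w ^+ k))^*%C * (w ^+ k) ^+ (N - d) = 0.
  transitivity ((\sum_(k < N) p (r%:C%C * w ^+ k) * (w ^+ k) ^+ d)^*)%C.
    rewrite rmorph_sum; apply: eq_bigr => k _.
    by rewrite rmorphM /= -conj_w conjcK.
  rewrite sum_p big1 ?rmorph0 // => m _; rewrite sum_expr_prim_root ?mulr0 //.
  apply/negP => /dvdnP[q]; have := ltn_ord m; rewrite /N.
  by case: q => [|q]; nia.
have N0 : 0 < N%:R :> R by rewrite ltr0n.
rewrite -(ler_pM2l N0).
have -> : N%:R * (normc (c d) * r ^+ d) = normc (N%:R * (c d * r%:C%C ^+ d)).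
  rewrite !normcM normcX normc_real ger0_norm //; congr (_ * _).
  by rewrite normc_nat.
(* Subtracting the vanishing sum replaces p by p - conj(p) = 2i Im p, of modulus at most 2B. *)
rewrite -Dp -[X in normc X]subr0 -[X in _ - X]Dc -sumrB.
apply: le_trans (normc_sum _ _ _) _.
have -> : N%:R * (2 * B) = \sum_(k < N) (2 * B).
  by rewrite sumr_const card_ord mulr_natl.
apply: ler_sum => k _.
rewrite -mulrBl normcM !normcX w1 !expr1n mulr1 subcJ !normcM.
rewrite normc_real normc_nat.
rewrite [normc 'i%C]/= expr0n expr1n add0r sqrtr1 mulr1 ler_pM2l //.
by apply: hB; rewrite normcM normcX w1 expr1n mulr1 normc_real ger0_norm.
Qed.

(** * Finite sets of multi-indices *)

Definition box (n M : nat) : seq (mindex n) :=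
  [seq mindex_of be | be <- index_enum {ffun 'I_n -> 'I_M.+1}].

(** [psum] runs over a simplex, while sums of products over the coordinates factor over a box; both
    truncations are needed. *)
Definition simplex (n M : nat) : seq (mindex n) :=
  [seq al <- box n M | (mdeg al <= M)%N].

Definition layer (n d : nat) : seq (mindex n) :=
  [seq al <- box n d | mdeg al == d].

Lemma mindex_of_inj n M : injective (@mindex_of n M).
Proof.
move=> x y /ffunP xy; apply/ffunP => j; apply/val_inj.
by have := xy j; rewrite !ffunE.
Qed.

Lemma box_uniq n M : uniq (box n M).
Proof. by rewrite map_inj_uniq ?index_enum_uniq //; exact: mindex_of_inj. Qed.

Lemma mem_box n M (al : mindex n) : (al \in box n M) = [forall j, (al j <= M)%N].
Proof.
apply/mapP/forallP => [[be _ ->] j|le_al]; first by rewrite ffunE -ltnS.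
exists [ffun j => inord (al j)]; first by rewrite mem_index_enum.
by apply/ffunP => j; rewrite !ffunE inordK // ltnS.
Qed.

Lemma leq_mdeg n (al : mindex n) j : (al j <= mdeg al)%N.
Proof. by rewrite /mdeg (bigD1 j) //= leq_addr. Qed.

Lemma mem_simplex n M (al : mindex n) : (al \in simplex n M) = (mdeg al <= M)%N.
Proof.
rewrite mem_filter mem_box; case: leqP => //= le_al.
by apply/forallP => j; exact: leq_trans (leq_mdeg al j) le_al.
Qed.

Lemma mem_layer n d (al : mindex n) : (al \in layer n d) = (mdeg al == d).
Proof.
rewrite mem_filter mem_box; case: eqP => //= <-.
by apply/forallP => j; apply: leq_mdeg.
Qed.

Lemma simplex_uniq n M : uniq (simplex n M).
Proof. exact/filter_uniq/box_uniq. Qed.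

Lemma layer_uniq n M : uniq (layer n M).
Proof. exact/filter_uniq/box_uniq. Qed.

Lemma sum_simplex (V : nmodType) n M (f : mindex n -> V) :
  \sum_(al <- simplex n M) f al = \sum_(d < M.+1) \sum_(al <- layer n d) f al.
Proof.
elim: M => [|M ih].
  rewrite big_ord1; apply: perm_big; apply: uniq_perm.
  - exact: simplex_uniq.
  - exact: layer_uniq.
  - by move=> al; rewrite mem_simplex mem_layer leqn0.
rewrite big_ord_recr -ih -big_cat; apply: perm_big; apply: uniq_perm.
- exact: simplex_uniq.
- rewrite cat_uniq simplex_uniq layer_uniq andbT /=; apply/hasPn => al.
  by rewrite mem_layer mem_simplex => /eqP ->; rewrite ltnn.
- move=> al; rewrite mem_cat !mem_simplex mem_layer leq_eqVlt ltnS.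
  by rewrite orbC.
Qed.

Lemma sum_box_prod (K : comPzRingType) n M (f : 'I_n -> nat -> K) :
  \sum_(al <- box n M) \prod_j f j (al j) = \prod_j \sum_(k < M.+1) f j k.
Proof.
rewrite bigA_distr_bigA big_map; apply: eq_bigr => be _.
by apply: eq_bigr => j _; rewrite ffunE.
Qed.

Lemma psumE (R : realType) n (a : mindex n -> R[i]) z M :
  psum a z M = \sum_(al <- simplex n M) a al * monom z al.
Proof. by rewrite big_filter big_map. Qed.

(** * Comparison of finite sums with [esum] *)

Lemma fsbig_set_seq (R : Type) (idx : R) (op : Monoid.com_law idx)
    (T : choiceType) (s : seq T) (f : T -> R) :
  uniq s -> \big[op/idx]_(x \in [set` s]%classic) f x = \big[op/idx]_(x <- s) f x.
Proof.
move=> us; have fin_s : finite_set [set` s]%classic by exact: finite_seq.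
rewrite fsbig_finite //; apply: perm_big.
apply: uniq_perm => // x.
by rewrite in_fset_set // mem_setE.
Qed.

Lemma sum_le_esum (R : realType) (T : choiceType) (s : seq T) (f : T -> R) (K : R) :
  uniq s -> (forall x, 0 <= f x) ->
  (\esum_(x in [set: T]%classic) (f x)%:E <= K%:E)%E -> \sum_(x <- s) f x <= K.
Proof.
move=> us f0 leK; rewrite -lee_fin; apply: le_trans leK; apply: esum_ge.
exists [set` s]%classic; first by split => //; exact: finite_seq.
by rewrite fsbig_set_seq // sumEFin.
Qed.

Lemma esum_seq (R : realType) (T : choiceType) (s : seq T) (f : T -> R) :
  uniq s -> (forall x, 0 <= f x) -> (forall x, x \notin s -> f x = 0) ->
  (\esum_(x in [set: T]%classic) (f x)%:E = (\sum_(x <- s) f x)%:E)%E.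
Proof.
move=> us f0 fs; have fin_s : finite_set [set` s]%classic by exact: finite_seq.
transitivity (\esum_(x in [set` s]%classic) (f x)%:E)%E.
  rewrite [RHS]esum_mkcond; apply: eq_esum => x _.
  by case: ifPn => // xs; rewrite fs //; apply: contra xs; rewrite mem_setE.
rewrite esum_fset //; last by move=> x _; rewrite lee_fin.
by rewrite fsbig_set_seq // sumEFin.
Qed.

(** * Truncated exponentials and point evaluation on the Fock space *)

Lemma cauchy_schwarz_sum (K : realFieldType) (I : Type) (s : seq I) (x y : I -> K) :
  (\sum_(i <- s) x i * y i) ^+ 2
    <= (\sum_(i <- s) x i ^+ 2) * (\sum_(i <- s) y i ^+ 2).
Proof.
rewrite -subr_ge0.
(* Lagrange's identity. *)
suff -> : (\sum_(i <- s) x i ^+ 2) * (\sum_(i <- s) y i ^+ 2)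
    - (\sum_(i <- s) x i * y i) ^+ 2
    = 2^-1 * \sum_(i <- s) \sum_(j <- s) (x i * y j - x j * y i) ^+ 2.
  by apply: mulr_ge0 => //; do 2![apply: sumr_ge0 => ? _]; exact: sqr_ge0.
have sqr_sum : \sum_(i <- s) \sum_(j <- s) (x i * y j - x j * y i) ^+ 2
    = \sum_(i <- s) (x i ^+ 2 * (\sum_(j <- s) y j ^+ 2)
       + y i ^+ 2 * (\sum_(j <- s) x j ^+ 2)
       - 2 * (x i * y i) * (\sum_(j <- s) x j * y j)).
  apply: eq_bigr => i _; rewrite !mulr_sumr -big_split -sumrB.
  by apply: eq_bigr => j _ /=; ring.
rewrite sqr_sum sumrB big_split /= -!mulr_suml -mulr_sumr.
by field.
Qed.

Lemma normc_limit_le (R : realType) n (a : mindex n -> R[i]) z l (B : R) :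
  (forall m, normc (psum a z m) <= B) -> series_to a z l -> normc l <= B.
Proof.
move=> leB al; apply/ler_addgt0Pr => e /al[N /(_ N (leqnn N)) h].
have -> : l = psum a z N - (psum a z N - l) by rewrite opprB addrC subrK.
apply: le_trans (le_normcD _ _) _; rewrite normcN.
by apply: lerD; [exact: leB|exact: ltW].
Qed.

(** The power series of exp(sum_j t_j) truncated to a box, in factored form. *)
Definition expsum (R : realType) n M (t : 'I_n -> R) : R :=
  \prod_j \sum_(k < M.+1) t j ^+ k / k`!%:R.

Lemma sum_exp_coeff (R : realType) M (x : R) :
  \sum_(k < M.+1) x ^+ k / k`!%:R = series (exp_coeff x) M.+1.
Proof. by rewrite /series /= big_mkord. Qed.

Lemma expsum_le (R : realType) n M (t : 'I_n -> R) :
  (forall j, 0 <= t j) -> expsum M t <= expR (\sum_j t j).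
Proof.
move=> t0; rewrite expR_sum; apply: ler_prod => j _; apply/andP; split.
  by apply: sumr_ge0 => k _; rewrite divr_ge0 ?exprn_ge0.
rewrite sum_exp_coeff; apply: nondecreasing_cvgn_le.
  apply/nondecreasing_seqP => k; rewrite seriesSr lerDl; exact: exp_coeff_ge0.
exact: is_cvg_series_exp_coeff.
Qed.

Lemma expsum_gt0 (R : realType) n M (t : 'I_n -> R) :
  (forall j, 0 <= t j) -> 0 < expsum M t.
Proof.
move=> t0; apply: prodr_gt0 => j _; rewrite big_ord_recl expr0 divr1.
by rewrite ltr_pwDl // sumr_ge0 // => k _; rewrite divr_ge0 ?exprn_ge0.
Qed.

Lemma expR_sum_le (R : realType) n (t : 'I_n -> R) (X : R) :
  (forall M, expsum M t <= X) -> expR (\sum_j t j) <= X.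
Proof.
move=> leX.
have cv : (expsum M t @[M --> \oo] --> expR (\sum_j t j))%classic.
  rewrite expR_sum; apply: cvg_big => [|j _].
    exact: mul_continuous.
  under eq_cvg do rewrite sum_exp_coeff.
  have : (series (exp_coeff (t j)) @ \oo --> expR (t j))%classic.
    exact: is_cvg_series_exp_coeff.
  (* [expsum M] has M + 1 terms in each factor, hence the shift by one. *)
  by rewrite -(@cvg_shiftS R^o).
rewrite -(cvg_lim _ cv) //; apply: limr_le; first by apply/cvg_ex; eexists; exact: cv.
by apply: nearW.
Qed.

Definition sqnorm (R : realType) n (z : 'cV[R[i]]_n) (j : 'I_n) : R := normc (z j 0) ^+ 2.

Lemma normc_monom_sqr (R : realType) n (z : 'cV[R[i]]_n) (al : mindex n) :
  normc (monom z al) ^+ 2 / (mfact al)%:R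
   = \prod_j (sqnorm z j ^+ al j / (al j)`!%:R).
Proof.
rewrite /monom /mfact big_split /= prodfV natr_prod; congr (_ / _).
rewrite (big_morph (@normc R) (@normcM R) (normc1 R)) -prodrXl.
by apply: eq_bigr => j _; rewrite normcX /sqnorm -!exprM mulnC.
Qed.

Lemma sum_box_monom (R : realType) n M (z : 'cV[R[i]]_n) :
  \sum_(al <- box n M) normc (monom z al) ^+ 2 / (mfact al)%:R = expsum M (sqnorm z).
Proof.
under eq_bigr do rewrite normc_monom_sqr.
by rewrite (sum_box_prod M (fun j k => sqnorm z j ^+ k / k`!%:R)).
Qed.

Lemma mfact_gt0 (R : realType) n (al : mindex n) : 0 < (mfact al)%:R :> R.
Proof. by rewrite ltr0n /mfact; apply: prodn_gt0 => j; exact: fact_gt0. Qed.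

Lemma sqnorm_ge0 (R : realType) n (z : 'cV[R[i]]_n) j : 0 <= sqnorm z j.
Proof. exact: sqr_ge0. Qed.

(** Cauchy-Schwarz with the weights sqrt(alpha!) bounds every partial sum, and the bound passes to
    the limit. *)
Lemma fock_bound (R : realType) n (b : mindex n -> R[i]) z l (K : R) :
  (fock_norm2 b <= K%:E)%E -> series_to b z l ->
  normc l ^+ 2 <= K * expR (\sum_j sqnorm z j).
Proof.
move=> bK bl.
have K0 : 0 <= K.
  rewrite -lee_fin (le_trans _ bK) // esum_ge0 // => al _.
  by rewrite lee_fin mulr_ge0 ?sqr_ge0.
have Q0 : 0 <= K * expR (\sum_j sqnorm z j) by rewrite mulr_ge0 ?expR_ge0.
rewrite -(sqr_sqrtr Q0) ler_pXn2r ?nnegrE ?normc_ge0 ?sqrtr_ge0 //.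
apply: normc_limit_le bl => m.
rewrite -(@ler_pXn2r _ 2) ?nnegrE ?normc_ge0 ?sqrtr_ge0 // sqr_sqrtr // psumE.
have f0 al : 0 < (mfact al)%:R :> R := mfact_gt0 R al.
pose s (al : mindex n) : R := Num.sqrt (mfact al)%:R.
have s0 al : s al != 0 by rewrite gt_eqF // sqrtr_gt0.
have s2 al : s al ^+ 2 = (mfact al)%:R by rewrite sqr_sqrtr ?ltW.
have le1 : normc (\sum_(al <- simplex n m) b al * monom z al)
    <= \sum_(al <- simplex n m) (normc (b al) * s al) * (normc (monom z al) / s al).
  apply: le_trans (normc_sum _ _ _) _; apply: ler_sum => al _.
  by rewrite normcM mulrACA mulfV ?mulr1.
apply: (@le_trans _ _ ((\sum_(al <- simplex n m)
    (normc (b al) * s al) * (normc (monom z al) / s al)) ^+ 2)).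
  by rewrite ler_pXn2r // nnegrE ?normc_ge0 // (le_trans _ le1) ?normc_ge0.
apply: le_trans (cauchy_schwarz_sum _ _ _) _; apply: ler_pM.
- by apply: sumr_ge0 => ? _; exact: sqr_ge0.
- by apply: sumr_ge0 => ? _; exact: sqr_ge0.
- under eq_bigr do rewrite exprMn s2.
  apply: sum_le_esum => //; first exact: simplex_uniq.
  by move=> al; rewrite mulr_ge0 ?sqr_ge0.
(* The terms are nonnegative, so the simplex may be enlarged to the box, where the sum is
   [expsum]. *)
- under eq_bigr do rewrite expr_div_n s2.
  apply: le_trans (expsum_le m (sqnorm_ge0 z)); rewrite -sum_box_monom.
  rewrite big_filter big_mkcond; apply: ler_sum => al _.
  by case: ifP => // _; rewrite divr_ge0 ?sqr_ge0 ?ltW.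
Qed.

(** * Truncated kernel functions *)

(* Truncated Taylor coefficients of exp(sum_j z_j conj(w_j)); the kernel at w
   is this function times exp(-z^2/2), up to the constant exp(-conj(w)^2/2). *)
Definition kernel_coef (R : realType) n M (w : 'cV[R[i]]_n) (al : mindex n) : R[i] :=
  if al \in box n M then (monom w al)^*%C / (mfact al)%:R else 0.

Lemma fock_norm2_kernel (R : realType) n M (w : 'cV[R[i]]_n) :
  fock_norm2 (kernel_coef M w) = (expsum M (sqnorm w))%:E.
Proof.
rewrite /fock_norm2 (@esum_seq _ _ (box n M)) ?box_uniq //.
- congr (_%:E); rewrite -sum_box_monom; apply: eq_big_seq => al al_box.
  have f0 : (mfact al)%:R != 0 :> R by rewrite gt_eqF ?mfact_gt0.
  rewrite /kernel_coef al_box normcM normc_conj normcV normc_nat.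
  by field.
- by move=> al; rewrite mulr_ge0 ?sqr_ge0.
- by move=> al /negPf; rewrite /kernel_coef => ->; rewrite normc0 expr0n mul0r.
Qed.

(** Multi-indices in the box have degree at most nM, so the partial sums are constant from there
    on. *)
Lemma psum_kernel (R : realType) n M (w z : 'cV[R[i]]_n) m : (n * M <= m)%N ->
  psum (kernel_coef M w) z m = \sum_(al <- box n M) kernel_coef M w al * monom z al.
Proof.
move=> nMm; rewrite psumE (bigID (fun al => al \in box n M)) /=.
rewrite [X in _ + X]big1 ?addr0 => [|al /negPf al_box]; last first.
  by rewrite /kernel_coef al_box mul0r.
rewrite -big_filter; apply: perm_big; apply: uniq_perm.
- exact/filter_uniq/simplex_uniq.
- exact: box_uniq.
move=> al; rewrite mem_filter mem_simplex; case: (boolP (al \in box n M)) => //=.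
rewrite mem_box => /forallP al_box; apply: leq_trans nMm.
have -> : (n * M = \sum_(j < n) M)%N by rewrite sum_nat_const card_ord.
by apply: leq_sum.
Qed.

Lemma HG_rep_kernel (R : realType) n M (w : 'cV[R[i]]_n) :
  HG_rep (kernel_coef M w) (fun z =>
    (\sum_(al <- box n M) kernel_coef M w al * monom z al)
      * cexp (- (sumsq z / 2%:R))).
Proof.
eexists; split; last by move=> z.
split=> [|z]; first by rewrite fock_norm2_kernel ltry.
move=> e e0; exists (n * M)%N => m nMm.
by rewrite psum_kernel // subrr normc0.
Qed.

(** The reproducing property survives truncation: the value at w is the squared norm found in
    [fock_norm2_kernel]. *)
Lemma kernel_diag (R : realType) n M (w : 'cV[R[i]]_n) :
  \sum_(al <- box n M) kernel_coef M w al * monom w al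
    = (expsum M (sqnorm w))%:C%C.
Proof.
rewrite -sum_box_monom rmorph_sum; apply: eq_big_seq => al al_box.
rewrite /kernel_coef al_box mulrAC [_^*%C * _]mulrC mulc_conj fmorph_div /=.
by rewrite rmorph_nat.
Qed.

(** * From boundedness to imaginary parts *)

Lemma normc_cexp_sqr (R : realType) (w : R[i]) :
  normc (cexp w) ^+ 2 = expR (2 * complex.Re w).
Proof.
case: w => x y /=; rewrite sqr_sqrtr ?addr_ge0 ?sqr_ge0 // !exprMn -mulrDr.
by rewrite cos2Dsin2 mulr1 -expRM_natl.
Qed.

Lemma Re_sum (R : rcfType) (I : Type) (s : seq I) (f : I -> R[i]) :
  complex.Re (\sum_(i <- s) f i) = \sum_(i <- s) complex.Re (f i).
Proof. by apply: (big_morph (@complex.Re R)) => // -[a b] [c d]. Qed.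

Lemma Re_opp_half (R : rcfType) (x : R[i]) :
  2 * complex.Re (- (x / 2%:R)) = - complex.Re x.
Proof.
have {2}-> : x = x / 2%:R + x / 2%:R by field.
by case: (x / 2%:R) => a b /=; ring.
Qed.

(** Both sides are the logarithm of K_G(z,z), the left one read off from the Fock kernel times the
    squared modulus of exp(-z^2/2). *)
Lemma sqnorm_sub_Re (R : realType) n (z : 'cV[R[i]]_n) :
  \sum_j sqnorm z j - complex.Re (sumsq z)
    = 2 * \sum_j complex.Im (z j 0) ^+ 2.
Proof.
rewrite /sumsq Re_sum mulr_sumr -sumrB; apply: eq_bigr => j _.
rewrite /sqnorm; case: (z j 0) => a b.
by rewrite /= sqr_sqrtr ?addr_ge0 ?sqr_ge0 //; ring.
Qed.

(* The kernel functions are truncated to polynomials times exp(-z^2/2), so that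
   all norms are finite sums until the truncation is removed by [expR_sum_le]. *)
Lemma koopman_Im_bound (R : realType) n (F : 'cV[R[i]]_n -> 'cV[R[i]]_n) :
  koopman_bounded F -> exists C : R, 0 <= C /\ forall z,
    \sum_j complex.Im (F z j 0) ^+ 2 <= C ^+ 2 + \sum_j complex.Im (z j 0) ^+ 2.
Proof.
move=> [C [C0 bndF]]; exists C; split=> // z; pose w := F z.
suff exp_le : expR (2 * \sum_j complex.Im (w j 0) ^+ 2)
    <= C ^+ 2 * expR (2 * \sum_j complex.Im (z j 0) ^+ 2).
  (* C^2 <= exp(C^2) is used instead of a logarithm of C, which may be 0. *)
  have : expR (2 * \sum_j complex.Im (w j 0) ^+ 2)
      <= expR (C ^+ 2 + 2 * \sum_j complex.Im (z j 0) ^+ 2).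
    apply: le_trans exp_le _; rewrite expRD ler_pM2r ?expR_gt0 //.
    by apply: le_trans (expR_ge1Dx _); rewrite lerDr.
  by rewrite ler_expR; have := sqr_ge0 C; lra.
(* This isolates exp(|w|^2), the factor that is replaced by its truncations. *)
rewrite -!sqnorm_sub_Re !expRD mulrA -ler_pdivlMr ?expR_gt0 //.
apply: expR_sum_le => M; rewrite ler_pdivlMr ?expR_gt0 //.
have E0 : 0 < expsum M (sqnorm w) by apply: expsum_gt0 => j; exact: sqnorm_ge0.
(* The truncated kernel at w = F z is composed with F and evaluated at z. With E =
   [expsum M (sqnorm w)], the left side carries E^2 and [fock_bound] gives C^2 E on the right, so
   one factor E cancels. *)
have [b [[g [[_ bg] hg]] bC]] := bndF _ _ (HG_rep_kernel M w).
have := hg z; rewrite kernel_diag => /(congr1 (fun x => normc x ^+ 2)).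
rewrite !normcM !exprMn !normc_cexp_sqr !Re_opp_half normc_real (gtr0_norm E0).
move=> eq_h; rewrite -(ler_pM2l E0) mulrA -expr2 eq_h mulrA ler_pM2r ?expR_gt0 //.
rewrite mulrA [_ * C ^+ 2]mulrC; apply: fock_bound (bg z).
by rewrite EFinM -fock_norm2_kernel.
Qed.

(** * Restriction to complex lines and vanishing of the higher homogeneous parts *)

(* The homogeneous part of degree d of the power series, evaluated at z. *)
Definition hpart (R : realType) n (a : mindex n -> R[i]) z d : R[i] :=
  \sum_(al <- layer n d) a al * monom z al.

Lemma monomZ (R : realType) n (l : R[i]) (z : 'cV[R[i]]_n) al :
  monom (l *: z) al = l ^+ mdeg al * monom z al.
Proof.
rewrite /monom /mdeg -prodrXr -big_split; apply: eq_bigr => j _.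
by rewrite mxE exprMn.
Qed.

(** Truncation by total degree makes each partial sum a polynomial in l, to which [coef_le_Im]
    applies. *)
Lemma psum_scale (R : realType) n (a : mindex n -> R[i]) z l M :
  psum a (l *: z) M = \sum_(d < M.+1) hpart a z d * l ^+ d.
Proof.
rewrite psumE sum_simplex; apply: eq_bigr => d _.
rewrite mulr_suml; apply: eq_big_seq => al; rewrite mem_layer => /eqP al_d.
by rewrite monomZ al_d mulrAC mulrA.
Qed.

Lemma sum_simplex_split (V : nmodType) n M m (f : mindex n -> V) : (M <= m)%N ->
  \sum_(al <- simplex n m) f al
    = \sum_(al <- simplex n M) f al + \sum_(al <- simplex n m | (M < mdeg al)%N) f al.
Proof.
move=> Mm; rewrite (bigID (fun al => mdeg al <= M)%N) /=; congr (_ + _).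
  rewrite -big_filter; apply: perm_big; apply: uniq_perm.
  - exact/filter_uniq/simplex_uniq.
  - exact: simplex_uniq.
  - move=> al; rewrite mem_filter !mem_simplex; case: leqP => //= le_al.
    exact: leq_trans Mm.
by apply: eq_bigl => al; rewrite ltnNge.
Qed.

(** The moduli of the terms at l z depend only on |l| = r, so the absolutely convergent series at r
    z controls the tails uniformly in l. *)
Lemma psum_circle_approx (R : realType) n (f : 'cV[R[i]]_n -> R[i]) a z (r : R) d :
  0 <= r -> (forall x, abs_summable a x /\ series_to a x (f x)) ->
  exists2 M, (d <= M)%N &
    forall l, normc l = r -> normc (f (l *: z) - psum a (l *: z) M) <= 1.
Proof.
move=> r0 af; pose g (al : mindex n) := normc (a al * monom (r%:C%C *: z) al).
have g0 al : 0 <= g al by exact: normc_ge0.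
pose T k := \sum_(al <- simplex n (d + k)) g al.
have [K TK] : exists K, forall k, T k <= K.
  have [sum_fin _] := af (r%:C%C *: z).
  exists (fine (\esum_(al in [set: mindex n]%classic) (g al)%:E)) => k.
  apply: sum_le_esum => //; first exact: simplex_uniq.
  rewrite fineK // ge0_fin_numE //; apply: esum_ge0 => al _.
  by rewrite lee_fin.
have supT : has_sup (range T).
  by split; [exists (T 0), 0%N | exists K => _ [k _ <-]].
have [_ [k _ <-] Tk] := sup_adherent (ltr01 : 0 < 1 :> R) supT.
exists (d + k)%N => [|l lr]; first exact: leq_addr.
have g_l al : normc (a al * monom (l *: z) al) = g al.
  by rewrite /g !monomZ !normcM !normcX lr normc_real ger0_norm.
apply/ler_addgt0Pr => e e0.
(* N depends on l and e, but serves only to reach a later partial sum; the truncation d + k stays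
   fixed. *)
have [N hN] := (af (l *: z)).2 e e0; pose k' := (N + k)%N.
have dkk' : (d + k <= d + k')%N by lia.
have := hN (d + k')%N ltac:(lia) => /ltW near_f.
have tail : normc (psum a (l *: z) (d + k') - psum a (l *: z) (d + k)) <= 1.
  rewrite !psumE (sum_simplex_split _ dkk') addrAC subrr add0r.
  apply: le_trans (normc_sum _ _ _) _; under eq_bigr do rewrite g_l.
  have Tk' : T k' <= sup (range T) by apply: sup_upper_bound => //; exists k'.
  by have := sum_simplex_split g dkk'; rewrite -/(T k) -/(T k'); lra.
have -> : f (l *: z) - psum a (l *: z) (d + k)
    = (psum a (l *: z) (d + k') - psum a (l *: z) (d + k))
      - (psum a (l *: z) (d + k') - f (l *: z)) by ring.
apply: le_trans (le_normcD _ _) _; rewrite normcN.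
exact: lerD.
Qed.

Lemma normc_ge_Im (R : rcfType) (x : R[i]) : `|complex.Im x| <= normc x.
Proof.
case: x => a b /=; rewrite -sqrtr_sqr ler_sqrt ?lerDr ?addr_ge0 ?sqr_ge0 //.
Qed.

Lemma ImD (R : rcfType) (x y : R[i]) :
  complex.Im (x + y) = complex.Im x + complex.Im y.
Proof. by case: x y => [a b] [c d]. Qed.

Lemma eq0_linear_growth (R : realFieldType) (p A L : R) d :
  (1 < d)%N -> 0 <= p -> 0 <= A -> 0 <= L ->
  (forall r, 0 <= r -> p * r ^+ d <= A + r * L) -> p = 0.
Proof.
move=> d1 p0 A0 L0 grow; apply/eqP; rewrite eq_le p0 andbT leNgt; apply/negP => p_gt0.
(* At this radius p r = p + A + L exceeds A + L, whereas r >= 1 and the growth bound force p r^2 <=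
   r (A + L). *)
pose r := 1 + (A + L) / p.
have r1 : 1 <= r by rewrite /r lerDl divr_ge0 ?addr_ge0.
have r_gt0 : 0 < r by exact: lt_le_trans r1.
have pr : p * r = p + A + L by rewrite /r; field; rewrite gt_eqF.
have rd : r ^+ 2 <= r ^+ d by rewrite ler_weXn2l.
have le2 : p * r ^+ 2 <= r * (A + L).
  apply: le_trans (_ : A + r * L <= _); last by nra.
  by apply: le_trans (grow r (ltW r_gt0)); rewrite ler_pM2l.
by move: le2; rewrite expr2 mulrA pr; nra.
Qed.

(** On |l| = r the approximating polynomial has imaginary part at most C + r |z| + 1. Its degree may
    depend on r, but its coefficients [hpart a z d] do not, so r can vary freely. *)
Lemma hpart_eq0 (R : realType) n (f : 'cV[R[i]]_n -> R[i]) a (C : R) z d :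
  (forall x, abs_summable a x /\ series_to a x (f x)) -> 0 <= C ->
  (forall x, complex.Im (f x) ^+ 2 <= C ^+ 2 + \sum_j complex.Im (x j 0) ^+ 2) ->
  (1 < d)%N -> hpart a z d = 0.
Proof.
move=> af C0 fC d1; pose L := Num.sqrt (\sum_j sqnorm z j).
have L0 : 0 <= L by exact: sqrtr_ge0.
have L2 : L ^+ 2 = \sum_j sqnorm z j.
  by rewrite sqr_sqrtr // sumr_ge0 // => j _; exact: sqnorm_ge0.
apply: eq0_normc; apply: (@eq0_linear_growth _ _ (2 * (C + 1)) (2 * L) d) => //.
- exact: normc_ge0.
- by rewrite mulr_ge0 ?addr_ge0.
- by rewrite mulr_ge0.
move=> r r0; have [M dM approx] := psum_circle_approx z d r0 af.
have -> : 2 * (C + 1) + r * (2 * L) = 2 * (C + r * L + 1) by ring.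
apply: (@coef_le_Im _ (hpart a z) M) => // [|l lr]; first by rewrite dM ltnW.
rewrite -psum_scale.
have Im_f : `|complex.Im (f (l *: z))| <= C + r * L.
  have CrL0 : 0 <= C + r * L by rewrite addr_ge0 ?mulr_ge0.
  rewrite -(@ler_pXn2r _ 2) ?nnegrE // real_normK ?num_real //.
  apply: le_trans (fC _) _.
  suff Im_z : \sum_j complex.Im ((l *: z) j 0) ^+ 2 <= r ^+ 2 * L ^+ 2.
    by apply: (le_trans (lerD (lexx _) Im_z)); have := mulr_ge0 C0 (mulr_ge0 r0 L0); nra.
  rewrite L2 mulr_sumr; apply: ler_sum => j _; rewrite mxE /sqnorm -exprMn -lr -normcM.
  by rewrite -real_normK ?num_real // ler_pXn2r ?nnegrE ?normc_ge0 // normc_ge_Im.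
have -> : psum a (l *: z) M = f (l *: z) + - (f (l *: z) - psum a (l *: z) M) by ring.
rewrite ImD; apply: le_trans (ler_normD _ _) _; apply: lerD => //.
by apply: le_trans (normc_ge_Im _) _; rewrite normcN; exact: approx.
Qed.

(** * Degrees 0 and 1, and the affine form *)

Lemma monom_mdeg0 (R : realType) n (z : 'cV[R[i]]_n) al :
  mdeg al = 0%N -> monom z al = 1.
Proof.
move=> al0; apply: big1 => j _.
by have := leq_mdeg al j; rewrite al0 leqn0 => /eqP ->.
Qed.

(** Such an index is a unit vector; the sum names its monomial without naming the coordinate, ready
    for a matrix product. *)
Lemma monom_mdeg1 (R : realType) n (z : 'cV[R[i]]_n) al :
  mdeg al = 1%N -> monom z al = \sum_j (al j)%:R * z j 0.
Proof.
move=> al1; have [j alj] : exists j, al j != 0%N.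
  apply/existsP; apply: contraPT al1 => /existsPn al0.
  by rewrite /mdeg big1 // => j _; apply/eqP; have := al0 j; rewrite negbK.
move: al1; rewrite /mdeg (bigD1 j) //= => al1.
have [alj1 /eqP] : al j = 1%N /\ (\sum_(i < n | i != j) al i = 0)%N.
  by case: (al j) alj al1 => [|[|k]] // _ [].
rewrite sum_nat_eq0 => /forallP al0.
have alk k : k != j -> al k = 0%N by move=> kj; apply/eqP; exact: (implyP (al0 k)).
rewrite /monom !(bigD1 (P := predT) j) //= alj1 expr1 mul1r.
rewrite big1 => [|k /alk ->]; last by rewrite expr0.
by rewrite big1 => [|k /alk ->]; rewrite ?mul0r // mulr1 addr0.
Qed.

Lemma series_to_affine (R : realType) n (a : mindex n -> R[i]) z l :
  (forall d, (1 < d)%N -> hpart a z d = 0) -> series_to a z l ->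
  l = hpart a z 0 + hpart a z 1.
Proof.
move=> hp0 al; apply/eqP; rewrite eq_sym -subr_eq0; apply/eqP/eq0_normc.
apply/eqP; rewrite eq_le normc_ge0 andbT; apply/ler_addgt0Pr => e /al[N hN].
(* The index [N.+1] ensures that degrees 0 and 1 are both present in the partial sum. *)
rewrite add0r; have := hN N.+1 (leqnSn N) => /ltW.
rewrite -{1}(scale1r z) psum_scale !big_ord_recl big1 => [|d _].
  by rewrite !expr1n !mulr1 addr0.
by rewrite hp0 ?mul0r // /bump /=; lia.
Qed.

Theorem theorem1 (R : realType) (n : nat) (F : 'cV[R[i]]_n -> 'cV[R[i]]_n) :
  entire_map F -> koopman_bounded F ->
  exists (A : 'M[R[i]]_n) (b : 'cV[R[i]]_n), forall z, F z = A *m z + b.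
Proof.
move=> /choice[a aF] /koopman_Im_bound[C [C0 ImF]].
(* Only the k-th unit vector contributes, so the entry is the coefficient of z_k in F_j. *)
exists (\matrix_(j, k) \sum_(al <- layer n 1) a j al * (al k)%:R).
exists (\col_j \sum_(al <- layer n 0) a j al) => z.
apply/matrixP => j i; rewrite (ord1 i) !mxE.
have ImFj x : complex.Im (F x j 0) ^+ 2
    <= C ^+ 2 + \sum_k complex.Im (x k 0) ^+ 2.
  apply: le_trans (ImF x); rewrite [leRHS](bigD1 j) //= lerDl.
  by apply: sumr_ge0 => k _; exact: sqr_ge0.
rewrite (@series_to_affine _ _ (a j) z (F z j 0)).
- rewrite addrC; congr (_ + _).
    apply: eq_big_seq => al; rewrite mem_layer => /eqP al0.
    by rewrite monom_mdeg0 ?mulr1.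
  under [RHS]eq_bigr do rewrite mxE mulr_suml.
  rewrite exchange_big; apply: eq_big_seq => al; rewrite mem_layer => /eqP al1.
  by rewrite monom_mdeg1 // mulr_sumr; apply: eq_bigr => k _; rewrite mulrA.
- move=> d; exact: (hpart_eq0 z (aF j) C0 ImFj).
- exact: (aF j z).2.
Qed.
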